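(* Let $P$ be an acyclic solos term (with respect to some environment $\Gamma$). Then the solo diagram associated with $P$ is an acyclic solo diagram.
   Context: Triadic solos terms: $P ::= 0 \mid u(x_1x_2x_3) \mid \overline{u}\langle x_1x_2x_3\rangle \mid (P\mid P) \mid (\nu x)P$, where $(\nu x)P$ binds $x$; input solo $u(x_1x_2x_3)$, output solo $\overline u\langle x_1x_2x_3\rangle$, subject $u$, object occurrences $x_1,x_2,x_3$. Structural congruence: least congruence containing $\alpha$-equivalence and $0\mid P\equiv P$, $P\mid Q\equiv Q\mid P$, $(P\mid Q)\mid R\equiv P\mid(Q\mid R)$, $(\nu x)(\nu y)P\equiv(\nu y)(\nu x)P$, $(\nu x)0\equiv 0$, $((\nu x)P)\mid Q\equiv(\nu x)(P\mid Q)$ if $x$ not free in $Q$. Reduction: $(\nu \vec z)(\overline u\langle x_1x_2x_3\rangle\mid u(y_1y_2y_3)\mid P)\to P\sigma$ where $\sigma$ is a most general unifier of $x_1x_2x_3$ and $y_1y_2y_3$ such that exactly the names $w$ of $\vec z$ satisfy $\sigma(w)\neq w$; closed under parallel composition, restriction and structural congruence. Types, typing and protocols: types $V,W$; typed terms annotate restrictions $(\nu x^U)P$. $\Gamma\vdash P$ is derived by: $\Gamma\vdash 0$; $\Gamma\vdash P,\Gamma\vdash Q\Rightarrow\Gamma\vdash P\mid Q$; $\Gamma,x:U\vdash P\Rightarrow\Gamma\vdash(\nu x^U)P$; a solo (input or output) with subject $u$ and objects $a,b,c$ is typed by $\Gamma$ iff $\Gamma$ is defined on them and $(\Gamma(u),\Gamma(a),\Gamma(b),\Gamma(c))\in\{(V,W,W,V),(W,W,V,V)\}$.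 Each object occurrence gets a protocol $\mathsf S$ or $\mathsf R$: input with subject of type $V$: $\mathsf R,\mathsf S,\mathsf S$; input, subject type $W$: $\mathsf R,\mathsf S,\mathsf R$; output, subject type $V$: $\mathsf S,\mathsf R,\mathsf R$; output, subject type $W$: $\mathsf S,\mathsf R,\mathsf S$. Relations on solos $s,t$ of $P$ (bound names chosen pairwise distinct and distinct from free names): $x\in s$ iff $x$ has an object occurrence in $s$; $s\triangleleft x$ iff $x$ has an $\mathsf R$-occurrence in $s$; $s\triangleleft t$ iff $s\triangleleft\mathrm{subj}(t)$; $s\perp t$ iff same subject and opposite polarities; $s$ is a root iff no $t$ has $t\triangleleft s$; $\triangleleft^\star$ is the reflexive transitive closure. $P$ is an acyclic solos term w.r.t. $\Gamma$ if $\Gamma\vdash P$ and: (AC1) each name has at most one $\mathsf R$-occurrence; (AC2) $s\perp t$ implies $s,t$ are roots; (AC3) $s\triangleleft x$ and $x\in t$ imply $s\triangleleft^\star t$; (AC4) if $x$ has an $\mathsf S$-occurrence in $s$ and $s\triangleleft x$ then $s$ is an input; (AC5) no free name has an $\mathsf R$-occurrence. Solo diagrams: a finite set of nodes, each tagged free or bound, and a finite multiset of multiedges, each tagged input or output, each having a list of three source nodes and one target node; every node is a source or target of some multiedge. The diagram of a term $P$ (bound names distinct): one node per name occurring in $P$ (free iff the name is free in $P$), one multiedge per solo, from $[x_1,x_2,x_3]$ to $u$, input or output like the solo. Reduction of a diagram $G$: pick dual multiedges $e_1,e_2$ (opposite polarities, same target) with sources $[n_1,n_2,n_3]$ and $[m_1,m_2,m_3]$;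 erase them and add three undirected identification edges $\{n_i,m_i\}$ ($i=1,2,3$; loops and parallel edges allowed); let $I(G;e_1,e_2)$ be the multigraph on the nodes of $G$ with exactly these three edges. Then repeatedly contract an identification edge, identifying its endpoints provided at least one is bound (the resulting node is free iff one of them was free); the step succeeds if all identification edges are eliminated; nodes no longer source or target of a multiedge are removed. The pair $e_1,e_2$ is an acyclic redex if this reduction succeeds (never identifying two free nodes) and $I(G;e_1,e_2)$ is acyclic (no cycle, in particular no loop and no pair of parallel edges). A solo diagram $G$ is acyclic if, for every diagram $H$ reachable from $G$ by finitely many (zero or more) reduction steps, every pair of dual multiedges of $H$ is an acyclic redex. *)

(* Defs.v *)
From HB Require Import structures.
From Stdlib Require Export Relation_Operators.
From mathcomp Require Export all_boot finmap.

Set Implicit Arguments.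
Unset Strict Implicit.
Unset Printing Implicit Defensive.

Local Open Scope fset_scope.

(** * Terms *)

Definition name := nat.

Inductive polarity := Input | Output.

Definition is_input (p : polarity) : bool := if p is Input then true else false.
Definition polarity_of_bool (b : bool) : polarity := if b then Input else Output.
Lemma is_inputK : cancel is_input polarity_of_bool. Proof. by case. Qed.
HB.instance Definition _ := Countable.copy polarity (can_type is_inputK).

Inductive ty := V | W.

Record solo := Solo { pol : polarity; subj : name; obj : 3.-tuple name }.

Inductive term :=
| Nil
| Act of solo
| Par of term & term
| Nu of name & ty & term.

Fixpoint solos (P : term) : seq solo :=
  match P with
  | Nil => [::]
  | Act s => [:: s]
  | Par P Q => solos P ++ solos Q
  | Nu _ _ P => solos P
  end.

Definition solo_names (s : solo) : seq name := subj s :: obj s.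

Fixpoint fn (P : term) : {fset name} :=
  match P with
  | Nil => fset0
  | Act s => [fset x in solo_names s]
  | Par P Q => fn P `|` fn Q
  | Nu x _ P => fn P `\ x
  end.

Fixpoint bn (P : term) : seq name :=
  match P with
  | Nil | Act _ => [::]
  | Par P Q => bn P ++ bn Q
  | Nu x _ P => x :: bn P
  end.

Definition distinct_bn (P : term) : Prop :=
  uniq (bn P) /\ (forall x, x \in bn P -> x \notin fn P).

(* [same_name l x y]: [x] and [y] denote the same name, where [l] lists the
   pairs of binders crossed so far, innermost first. *)
Fixpoint same_name (l : seq (name * name)) (x y : name) : Prop :=
  match l with
  | [::] => x = y
  | (a, b) :: l => (x = a /\ y = b) \/ (x <> a /\ y <> b /\ same_name l x y)
  end.

Fixpoint alpha_under (l : seq (name * name)) (P Q : term) : Prop :=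
  match P, Q with
  | Nil, Nil => True
  | Act s, Act t =>
      [/\ pol s = pol t, same_name l (subj s) (subj t)
        & forall k, same_name l (tnth (obj s) k) (tnth (obj t) k)]
  | Par P1 P2, Par Q1 Q2 => alpha_under l P1 Q1 /\ alpha_under l P2 Q2
  | Nu x U P, Nu y U' Q => U = U' /\ alpha_under ((x, y) :: l) P Q
  | _, _ => False
  end.

Definition alpha_eq (P Q : term) : Prop := alpha_under [::] P Q.

(* [Q] is [P] with bound names chosen pairwise distinct and distinct from the
   free names. *)
Definition representative (P Q : term) : Prop := alpha_eq P Q /\ distinct_bn Q.

(** * Typing and protocols *)

Definition env := name -> option ty.

Definition extend (Gamma : env) (x : name) (U : ty) : env :=
  fun y => if y == x then Some U else Gamma y.

Definition typed_solo (Gamma : env) (s : solo) : Prop :=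
  (Gamma (subj s) = Some V /\
     map Gamma (obj s) = [:: Some W; Some W; Some V]) \/
  (Gamma (subj s) = Some W /\
     map Gamma (obj s) = [:: Some W; Some V; Some V]).

Inductive typed : env -> term -> Prop :=
| typed_Nil Gamma : typed Gamma Nil
| typed_Act Gamma s : typed_solo Gamma s -> typed Gamma (Act s)
| typed_Par Gamma P Q :
    typed Gamma P -> typed Gamma Q -> typed Gamma (Par P Q)
| typed_Nu Gamma x U P :
    typed (extend Gamma x U) P -> typed Gamma (Nu x U P).

(* The types of all the names of [P], free or bound; meaningful when
   [distinct_bn P]. *)
Fixpoint full_env (Gamma : env) (P : term) : env :=
  match P with
  | Nil | Act _ => Gamma
  | Par P Q => full_env (full_env Gamma P) Q
  | Nu x U P => full_env (extend Gamma x U) P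
  end.

Inductive protocol := ProtS | ProtR.

Definition protocols (p : polarity) (U : ty) : 3.-tuple protocol :=
  match p, U with
  | Input,  V => [tuple ProtR; ProtS; ProtS]
  | Input,  W => [tuple ProtR; ProtS; ProtR]
  | Output, V => [tuple ProtS; ProtR; ProtR]
  | Output, W => [tuple ProtS; ProtR; ProtS]
  end.

(** * Acyclic terms *)

(* A solo of [P] is an occurrence, hence an index in [solos P]: equal solos at
   different places of [P] are kept apart. *)
Definition solo_index (P : term) := 'I_(size (solos P)).

Definition solo_at (P : term) (s : solo_index P) : solo :=
  tnth (in_tuple (solos P)) s.

Section Acyclic.
Variables (Gamma : env) (P : term).
Implicit Types (x : name) (s t : solo_index P) (k : 'I_3).

Definition occurs_at x s k : Prop := tnth (obj (solo_at s)) k = x.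

Definition proto_occ (p : protocol) x s k : Prop :=
  occurs_at x s k /\
  exists2 U, full_env Gamma P (subj (solo_at s)) = Some U
           & tnth (protocols (pol (solo_at s)) U) k = p.

Definition in_solo x s : Prop := exists k, occurs_at x s k.
Definition prec_name s x : Prop := exists k, proto_occ ProtR x s k.
Definition prec s t : Prop := prec_name s (subj (solo_at t)).
Definition perp s t : Prop :=
  subj (solo_at s) = subj (solo_at t) /\ pol (solo_at s) <> pol (solo_at t).
Definition is_root s : Prop := forall t, ~ prec t s.
Definition prec_star : solo_index P -> solo_index P -> Prop :=
  clos_refl_trans _ prec.

Definition AC1 : Prop := forall x s k t l,
  proto_occ ProtR x s k -> proto_occ ProtR x t l -> s = t /\ k = l.
Definition AC2 : Prop := forall s t, perp s t -> is_root s /\ is_root t.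
Definition AC3 : Prop := forall s x t,
  prec_name s x -> in_solo x t -> prec_star s t.
Definition AC4 : Prop := forall x s,
  (exists k, proto_occ ProtS x s k) -> prec_name s x -> pol (solo_at s) = Input.
Definition AC5 : Prop := forall x s k, x \in fn P -> ~ proto_occ ProtR x s k.

End Acyclic.

Definition acyclic_term (Gamma : env) (P : term) : Prop :=
  typed Gamma P /\
  exists2 Q, representative P Q &
    [/\ AC1 Gamma Q, AC2 Gamma Q, AC3 Gamma Q, AC4 Gamma Q & AC5 Gamma Q].

(** * Solo diagrams *)

Definition node := nat.

Record multiedge := MultiEdge
  { epol : polarity; src : 3.-tuple node; tgt : node }.

Definition multiedge_to (e : multiedge) := (epol e, src e, tgt e).
Definition multiedge_of (u : polarity * 3.-tuple node * node) :=
  MultiEdge u.1.1 u.1.2 u.2.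
Lemma multiedge_toK : cancel multiedge_to multiedge_of. Proof. by case. Qed.
HB.instance Definition _ := Countable.copy multiedge (can_type multiedge_toK).

Definition edge_nodes (e : multiedge) : seq node := tgt e :: src e.

(* [edges] lists a finite multiset; the nodes not in [free] are bound. *)
Record diagram := Diagram
  { nodes : {fset node}; free : {fset node}; edges : seq multiedge }.

Definition touched (G : diagram) (n : node) : bool :=
  has (fun e => n \in edge_nodes e) (edges G).

Definition solo_diagram (G : diagram) : Prop :=
  [/\ forall n, n \in free G -> n \in nodes G,
      forall n, touched G n -> n \in nodes G
    & forall n, n \in nodes G -> touched G n].

Definition edge_of_solo (s : solo) : multiedge :=
  MultiEdge (pol s) (obj s) (subj s).

Definition diagram_of_distinct (Q : term) : diagram :=
  Diagram [fset x in flatten (map solo_names (solos Q))] (fn Q)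
          (map edge_of_solo (solos Q)).

Definition diagram_of (P : term) (G : diagram) : Prop :=
  exists2 Q, representative P Q & G = diagram_of_distinct Q.

(** * Reduction of diagrams *)

Definition dual (e1 e2 : multiedge) : Prop :=
  epol e1 <> epol e2 /\ tgt e1 = tgt e2.

(* Identification edges are undirected: [(n, m)] stands for [{n, m}]. *)
Definition id_edges (e1 e2 : multiedge) : seq (node * node) :=
  zip (src e1) (src e2).

Definition erase (e1 e2 : multiedge) (G : diagram) : diagram :=
  Diagram (nodes G) (free G) (rem e2 (rem e1 (edges G))).

(* Identification of [m] with [n]; the resulting node is called [n]. *)
Definition ident (n m z : node) : node := if z == m then n else z.

Definition ident_edge (n m : node) (e : multiedge) : multiedge :=
  MultiEdge (epol e) (map_tuple (ident n m) (src e)) (ident n m (tgt e)).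

(* Taking the image of [free G] makes the resulting node free iff [n] or [m]
   was free. *)
Definition identify (n m : node) (G : diagram) : diagram :=
  Diagram [fset ident n m z | z in nodes G] [fset ident n m z | z in free G]
          (map (ident_edge n m) (edges G)).

Inductive contract :
  diagram * seq (node * node) -> diagram * seq (node * node) -> Prop :=
| Contract G l n m :
    (n, m) \in l -> n \notin free G \/ m \notin free G ->
    contract (G, l)
      (identify n m G,
       [seq (ident n m d.1, ident n m d.2) | d <- rem (n, m) l]).

Definition eliminates (G : diagram) (l : seq (node * node)) (H : diagram) :=
  clos_refl_trans _ contract (G, l) (H, [::]).

Definition cleanup (G : diagram) : diagram :=
  Diagram [fset n in nodes G | touched G n] [fset n in free G | touched G n]
          (edges G).

Definition reduces_with (G : diagram) (e1 e2 : multiedge) (H : diagram) : Prop :=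
  exists2 G', eliminates (erase e1 e2 G) (id_edges e1 e2) G' & H = cleanup G'.

Definition dual_in (G : diagram) (e1 e2 : multiedge) : Prop :=
  [/\ e1 \in edges G, e2 \in edges G & dual e1 e2].

Definition reduces (G H : diagram) : Prop :=
  exists e1 e2, dual_in G e1 e2 /\ reduces_with G e1 e2 H.

(** * Acyclic diagrams *)

Record multigraph := Multigraph
  { vertices : {fset node}; uedges : seq (node * node) }.

Definition joins (M : multigraph) (i : 'I_(size (uedges M))) (x y : node) :=
  let d := tnth (in_tuple (uedges M)) i in d = (x, y) \/ d = (y, x).

(* Cycles of length [k.+1] with distinct vertices and distinct edge
   occurrences; [ordS] is the cyclic successor.  Loops are the cycles of length
   one, pairs of parallel edges those of length two. *)
Definition has_cycle (M : multigraph) : Prop :=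
  exists (k : nat) (v : 'I_k.+1 -> node) (e : 'I_k.+1 -> 'I_(size (uedges M))),
    [/\ injective v, injective e, forall i, v i \in vertices M
      & forall i, joins (e i) (v i) (v (ordS i))].

Definition id_graph (G : diagram) (e1 e2 : multiedge) : multigraph :=
  Multigraph (nodes G) (id_edges e1 e2).

Definition acyclic_redex (G : diagram) (e1 e2 : multiedge) : Prop :=
  (exists H, reduces_with G e1 e2 H) /\ ~ has_cycle (id_graph G e1 e2).

Definition acyclic_solo_diagram (G : diagram) : Prop :=
  solo_diagram G /\
  forall H, clos_refl_trans _ reduces G H ->
  forall e1 e2, dual_in H e1 e2 -> acyclic_redex H e1 e2.

(* Main.v *)
(** Call an identification edge's ends its [R]-end and its [S]-end: since dual
    solos carry opposite protocols, every identification edge has exactly one of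
    each.  By AC1 and AC5 the three [R]-ends are distinct bound nodes, so that
    the elimination succeeds.  As dual solos are roots, AC3 forbids an
    [R]-name of one to occur in the other, and then AC4 forbids three consecutive
    identification edges, oriented from [R]-end to [S]-end; but a cycle with
    distinct [R]-ends would be an oriented one.  Finally a solo that survives the
    reduction has no [R]-name among the identified nodes, again because dual solos
    are roots, so the relation between solos is just restricted and AC1-AC5 are
    preserved.  AC1-AC5 may be known for another representative than the one that
    gives the diagram; they are transported along the renaming of bound names. *)

From Stdlib Require Import Operators_Properties.
Require Import Defs.

Set Implicit Arguments.
Unset Strict Implicit.
Unset Printing Implicit Defensive.

Local Open Scope fset_scope.

(** * Acyclicity conditions on diagrams *)

Definition prot (T : node -> ty) (e : multiedge) (k : 'I_3) : protocol :=
  tnth (protocols (epol e) (T (tgt e))) k.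

Definition edge_prec (T : node -> ty) (E : seq multiedge) (a b : multiedge) :=
  [/\ a \in E, b \in E
    & exists2 k, prot T a k = ProtR & tnth (src a) k = tgt b].

Definition edge_reach (T : node -> ty) (E : seq multiedge) :=
  clos_refl_trans multiedge (edge_prec T E).

Definition typed_edge (T : node -> ty) (e : multiedge) : Prop :=
  map T (src e) = if T (tgt e) is V then [:: W; W; V] else [:: W; V; V].

Definition root_edge (T : node -> ty) (E : seq multiedge) (e : multiedge) :=
  forall d k, d \in E -> prot T d k = ProtR -> tnth (src d) k <> tgt e.

(* AC1-AC5 on diagrams.  Multiedges are compared as values instead of as
   occurrences: every multiedge has an [R]-source, so AC1 excludes duplicates. *)
Record acyclic_edges (T : node -> ty) (F : {fset node}) (E : seq multiedge)
    : Prop := AcyclicEdges {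
  ac_uniq : uniq E;
  ac_typed : forall e, e \in E -> typed_edge T e;
  ac_linear : forall d e k l, d \in E -> e \in E ->
    prot T d k = ProtR -> prot T e l = ProtR ->
    tnth (src d) k = tnth (src e) l -> d = e /\ k = l;
  ac_root : forall d e, d \in E -> e \in E -> dual d e -> root_edge T E d;
  ac_reach : forall d e k l, d \in E -> e \in E -> prot T d k = ProtR ->
    tnth (src d) k = tnth (src e) l -> edge_reach T E d e;
  ac_input : forall e k l, e \in E -> prot T e k = ProtR ->
    prot T e l = ProtS -> tnth (src e) k = tnth (src e) l -> epol e = Input;
  ac_free : forall e k, e \in E -> prot T e k = ProtR ->
    tnth (src e) k \notin F }.

Definition map_edge (f : node -> node) (e : multiedge) : multiedge :=
  MultiEdge (epol e) (map_tuple f (src e)) (f (tgt e)).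

Lemma dual_sym d e : dual d e -> dual e d.
Proof. by case=> p t; split=> // q; apply: p. Qed.

Lemma exists_protR p U : exists k, tnth (protocols p U) k = ProtR.
Proof.
by case: p U => [] [];
  [exists ord0|exists ord0|exists (Ordinal (isT : 1 < 3))|exists (Ordinal (isT : 1 < 3))].
Qed.

Lemma prot_dual T d e k : dual d e ->
  (prot T d k = ProtR /\ prot T e k = ProtS) \/
  (prot T d k = ProtS /\ prot T e k = ProtR).
Proof.
case=> + eq_t; rewrite /prot -eq_t.
by case: (epol d) (epol e) (T (tgt d)) k => [] [] [] [[|[|[|]]]] //= i np;
  rewrite !(tnth_nth ProtR) /=; auto.
Qed.

(** Ensures that identifications only join nodes of equal type, so that [T] is still a typing after
    a reduction. *)
Lemma typed_dual T d e k : dual d e -> typed_edge T d -> typed_edge T e ->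
  T (tnth (src d) k) = T (tnth (src e) k).
Proof.
case=> _ eq_t; rewrite /typed_edge -eq_t => <- td.
by rewrite !(tnth_nth 0) -!(nth_map 0 V) ?size_tuple // td.
Qed.

(** A root has no predecessor, so only the empty chain ends in it. With AC3, an [R]-name of [a] can
    then be an object of a root [b] only if [a = b]. *)
Lemma edge_reach_root T E a b : root_edge T E b -> edge_reach T E a b -> a = b.
Proof.
move=> + ab; elim: ab => {a b} [a b [aE _ [k kR eq_k]]|//|a b c _ IH1 _ IH2].
  by move=> /(_ a k aE kR).
by move=> rc; have eq_bc := IH2 rc; rewrite -eq_bc in rc *; apply: IH1.
Qed.

Lemma mem_rem2 (T : eqType) (s : seq T) x y z : uniq s ->
  (z \in rem y (rem x s)) = [&& z != y, z != x & z \in s].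
Proof. by move=> us; rewrite mem_rem_uniq ?rem_uniq // inE mem_rem_uniq // inE. Qed.

(** * Elimination of identification edges *)

Definition ends (l : seq (node * node)) : seq node := unzip1 l ++ unzip2 l.

Lemma ends_zip (s t : seq node) : size s = size t ->
  ends (zip s t) = s ++ t.
Proof. by move=> st; rewrite /ends unzip1_zip ?unzip2_zip ?st. Qed.

Lemma identP n m x y : ident n m x = ident n m y ->
  x = y \/ (x \in [:: n; m]) && (y \in [:: n; m]).
Proof.
rewrite /ident !inE; case: (x =P m) => [->|_]; case: (y =P m) => [->|_] e;
  by [left|right; rewrite -?e ?eqxx ?orbT].
Qed.

Lemma mem_ends_pair l n m : (n, m) \in l -> (n \in ends l) && (m \in ends l).
Proof.
move=> nml; rewrite !mem_cat (map_f fst nml : n \in unzip1 l).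
by rewrite (map_f snd nml : m \in unzip2 l) orbT.
Qed.

(** Keeps the merged nodes among the ends of the initial list during the induction over an
    elimination. *)
Lemma ends_ident n m d l x : (n, m) \in l ->
  ident n m x \in ends [seq (ident n m c.1, ident n m c.2) | c <- rem d l] ->
  x \in ends l.
Proof.
move=> nml xl; have /andP[nl ml] := mem_ends_pair nml.
have [z zl /identP[->//|/andP[+ _]]] : exists2 z, z \in ends l &
    ident n m x = ident n m z.
  move: xl; rewrite mem_cat /unzip1 /unzip2 -!map_comp.
  by case/orP=> /mapP[c /mem_rem cl /= ->];
    [exists c.1|exists c.2] => //; have := @mem_ends_pair l c.1 c.2;
    rewrite -surjective_pairing => /(_ cl) /andP[].
by rewrite !inE => /orP[]/eqP->.
Qed.

(** The successive identifications compose to a single map [f]. Whatever the order of contraction,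
    [f] preserves types and merges only ends of identification edges. *)
Lemma eliminates_map (T : node -> ty) G l H :
  (forall d, d \in l -> T d.1 = T d.2) -> eliminates G l H ->
  exists f, [/\ edges H = map (map_edge f) (edges G),
    forall x, x \in free H -> exists2 z, z \in free G & x = f z,
    forall x, T (f x) = T x
  & forall x y, f x = f y -> x = y \/ (x \in ends l) && (y \in ends l)].
Proof.
move=> Tl /clos_rt_rt1n_iff; move eqp: (G, l) => p; move eqq: (H, [::]) => q pq.
elim: pq G l eqp eqq Tl => {p q} [p G l <- [-> <-] _|p r q st _ IH G l eqp eqq Tl].
  exists id; split=> //; last by move=> ? ?; left.
    by rewrite -[LHS]map_id; apply: eq_map => -[po s t];
      congr MultiEdge; apply: val_inj; rewrite /= map_id.
  by move=> x; exists x.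
case: st eqp IH => {p r} G0 l0 n m nml _ [eqG eql]; subst G0 l0 => IH.
have Ti z : T (ident n m z) = T z.
  by rewrite /ident; case: eqP => // ->; apply: (Tl _ nml).

have [d|f [eH fH Tf kf]] := IH _ _ erefl eqq.
  by case/mapP=> c /mem_rem cl -> /=; rewrite !Ti; apply: Tl.
exists (f \o ident n m); split.
- rewrite eH -map_comp; apply: eq_map => e.
  by congr MultiEdge; apply: val_inj; rewrite /= -map_comp.
- by move=> x /fH[z /imfsetP[y /= yG ->] ->]; exists y.
- by move=> x /=; rewrite Tf Ti.
(* Nodes are merged either by this contraction, and then lie in [{n, m}], or later, and then their
   images are ends of the remaining edges. *)
- move=> x y /= /kf[/identP[->|]|/andP[xl yl]]; first by left.
    have /andP[nl ml] := mem_ends_pair nml.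
    by rewrite !inE => /andP[/orP[]/eqP-> /orP[]/eqP->]; right; rewrite ?nl ?ml.
  by right; rewrite (ends_ident nml xl) (ends_ident nml yl).
Qed.

(** The flag designates the future [R]-end; stored with the edge, it survives the relabelling of
    nodes. *)
Definition marked_end (c : bool * (node * node)) : node :=
  if c.1 then c.2.1 else c.2.2.

(** The head edge may be contracted since its marked end is bound. This end is neither free nor
    another marked end, so absorbing it leaves the other marked ends distinct and bound, as the
    induction requires. *)
Lemma eliminates_marked G (c : seq (bool * (node * node))) :
  uniq (map marked_end c) ->
  (forall x, x \in map marked_end c -> x \notin free G) ->
  exists H, eliminates G (map snd c) H.
Proof.
move sz: (size c) => k; elim: k c G sz => [|k IH] c G.
  by move=> /size0nil-> _ _; exists G; apply: rt_refl.
case: c => [//|[b [n m]] c] /= [sz] /andP[rc uc] Fc.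
pose c' := [seq (a.1, (ident n m a.2.1, ident n m a.2.2)) | a <- c].
have c'E : map marked_end c' = map (ident n m) (map marked_end c).
  by rewrite -!map_comp; apply: eq_map => -[[] []].
have r0F : marked_end (b, (n, m)) \notin free G by apply: Fc; rewrite inE eqxx.
have cF x : x \in map marked_end c -> x \notin free G.
  by move=> xc; apply: Fc; rewrite inE xc orbT.
(* Only [n] and [m] are merged, and one of them is the marked end: distinct nodes that avoid it stay
   apart. *)
have nr x y : ident n m x = ident n m y -> x != marked_end (b, (n, m)) ->
    y != marked_end (b, (n, m)) -> x = y.
  move=> /identP[//|]; rewrite !inE /marked_end /=.
  by case: b {rc r0F Fc} => /andP[/orP[]/eqP-> /orP[]/eqP->]; rewrite ?eqxx.
have neq x : x \in map marked_end c -> x != marked_end (b, (n, m)).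
  by apply: contraTneq => ->.
have [H el] : exists H, eliminates (identify n m G) (map snd c') H.
  apply: IH; first by rewrite size_map.
    rewrite c'E map_inj_in_uniq // => x y xc yc e.
    by apply: nr e _ _; apply: neq.
  move=> x; rewrite c'E => /mapP[y yc ->]; apply/imfsetP => -[z /= zF] e.
  have eq_yz : y = z.
    apply: nr e _ _; first exact: neq.
    by apply: contraTneq zF => ->.
  by have := cF _ yc; rewrite eq_yz zF.
exists H; apply: rt_trans el; apply: rt_step.
have -> : map snd c' =
    [seq (ident n m d.1, ident n m d.2) | d <- rem (n, m) ((n, m) :: map snd c)].
  by rewrite /= eqxx -!map_comp.
apply: Contract; first by rewrite inE eqxx.
by move: r0F; rewrite /marked_end /=; case: (b) => h; [left|right].
Qed.

(** * Acyclicity of redexes *)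

Definition is_R (p : protocol) : bool := if p is ProtR then true else false.

Lemma id_edgesE d e :
  id_edges d e = [seq (tnth (src d) k, tnth (src e) k) | k <- enum 'I_3].
Proof.
have sz : size (zip (src d) (src e)) = 3 by rewrite size_zip !size_tuple.
apply: (@eq_from_nth _ (0, 0)) => [|i]; rewrite sz; last move=> i3.
  by rewrite size_map size_enum_ord.
by rewrite nth_zip ?size_tuple // (nth_map ord0) ?size_enum_ord //
  !(tnth_nth 0) nth_enum_ord.
Qed.

Section Redex.
Variables (T : node -> ty) (F : {fset node}) (E : seq multiedge).
Hypothesis acE : acyclic_edges T F E.
Variables d e : multiedge.
Hypotheses (dE : d \in E) (eE : e \in E) (de : dual d e).

Definition rend (k : 'I_3) : node :=
  if is_R (prot T d k) then tnth (src d) k else tnth (src e) k.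
Definition send (k : 'I_3) : node :=
  if is_R (prot T d k) then tnth (src e) k else tnth (src d) k.

Lemma dual_neq : d <> e.
Proof. by move=> eq_de; case: de => np _; apply: np; rewrite eq_de. Qed.

Lemma redex_root_l : root_edge T E d. Proof. exact: (ac_root acE dE eE de). Qed.
Lemma redex_root_r : root_edge T E e. Proof. exact: (ac_root acE eE dE (dual_sym de)). Qed.

Lemma rendP k :
  [/\ prot T d k = ProtR, prot T e k = ProtS, rend k = tnth (src d) k
    & send k = tnth (src e) k] \/
  [/\ prot T d k = ProtS, prot T e k = ProtR, rend k = tnth (src e) k
    & send k = tnth (src d) k].
Proof.
by rewrite /rend /send; case: (prot_dual T k de) => -[-> ->]; [left|right].
Qed.

Lemma rend_inj : injective rend.
Proof.
move=> k l; case: (rendP k) (rendP l) => -[k1 k2 -> _] [] [l1 l2 -> _] eq_kl.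
- by case: (ac_linear acE dE dE k1 l1 eq_kl).
- by case: (ac_linear acE dE eE k1 l2 eq_kl) => /dual_neq.
- by case: (ac_linear acE eE dE k2 l1 eq_kl) => /esym/dual_neq.
- by case: (ac_linear acE eE eE k2 l2 eq_kl).
Qed.

Lemma rend_notin_free k : rend k \notin F.
Proof. by case: (rendP k) => -[k1 k2 -> _]; apply: (ac_free acE). Qed.

Lemma redex_cross_l k l : prot T d k = ProtR -> tnth (src d) k <> tnth (src e) l.
Proof.
move=> kR /(ac_reach acE dE eE kR) /(edge_reach_root redex_root_r).
exact: dual_neq.
Qed.

Lemma redex_cross_r k l : prot T e k = ProtR -> tnth (src e) k <> tnth (src d) l.
Proof.
move=> kR /(ac_reach acE eE dE kR) /(edge_reach_root redex_root_l) /esym.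
exact: dual_neq.
Qed.

(** The node [send a = rend b] cannot be shared across [d] and [e], so it has both protocols in one
    solo, which AC4 makes an input. The [S]-end of edge [b] lies in the dual solo, so
    [send b = rend c] makes that one an input as well, against opposite polarities. *)
Lemma send_chain a b c : send a = rend b -> send b = rend c -> False.
Proof.
have np : epol d <> epol e by case: de.
case: (rendP a) (rendP b) (rendP c) =>
    -[a1 a2 _ ->] [] [b1 b2 -> ->] [] [c1 c2 -> _] ab bc.
- exact: (redex_cross_l b1 (esym ab)).
- exact: (redex_cross_l b1 (esym ab)).
- apply: np; rewrite (ac_input acE eE b2 a2 (esym ab)).
  exact: (ac_input acE dE c1 b1 (esym bc)).
- exact: (redex_cross_r c2 (esym bc)).
- exact: (redex_cross_l c1 (esym bc)).
- apply: np; rewrite (ac_input acE dE b1 a1 (esym ab)).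
  by rewrite (ac_input acE eE c2 b2 (esym bc)).
- exact: (redex_cross_r b2 (esym ab)).
- exact: (redex_cross_r b2 (esym ab)).
Qed.

Lemma redex_no_cycle N : ~ has_cycle (Multigraph N (id_edges d e)).
Proof.
case=> k [v [p [v_inj p_inj _]]] /=.
have sz : size (id_edges d e) = 3 by rewrite id_edgesE size_map size_enum_ord.
pose q i := cast_ord sz (p i).
have q_inj : injective q by move=> i j /cast_ord_inj /p_inj.
move=> vp; have {}vp i : (rend (q i) = v i /\ send (q i) = v (ordS i)) \/
    (rend (q i) = v (ordS i) /\ send (q i) = v i).
  have := vp i; rewrite /joins /=.
  have -> : tnth (in_tuple (id_edges d e)) (p i) =
      (tnth (src d) (q i), tnth (src e) (q i)).
    by rewrite (tnth_nth (0, 0)) nth_zip ?size_tuple // !(tnth_nth 0).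
  by case: (rendP (q i)) => -[_ _ -> ->] [] [-> ->]; auto.
(* There are as many vertices as edges on the cycle, so each is an [R]-end. *)
have [w wP] : exists w : 'I_k.+1 -> 'I_k.+1, forall i, rend (q i) = v (w i).
  exists (fun i => if rend (q i) == v i then i else ordS i) => i.
  by case: eqP => // ne; case: (vp i) => -[].
have w_inj : injective w.
  by move=> i j eq_w; apply/q_inj/rend_inj; rewrite !wP eq_w.
have [w' _ wK] := injF_bij w_inj.
(* As [w] is bijective, every vertex of the cycle, hence every [S]-end, is the [R]-end of some cycle
   edge. *)
have next i : exists j, send (q i) = rend (q j).
  by case: (vp i) => -[_ ->]; [exists (w' (ordS i))|exists (w' i)]; rewrite wP wK.
(* Repetitions among [ord0], [a] and [b] are harmless, so loops and parallel edges are covered. *)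
have [a Ha] := next ord0; have [b Hb] := next a.
exact: send_chain Ha Hb.
Qed.

End Redex.

Lemma acyclic_edges_redex T G d e : acyclic_edges T (free G) (edges G) ->
  dual_in G d e -> acyclic_redex G d e.
Proof.
move=> acG [dG eG de]; split; last exact: (redex_no_cycle acG dG eG de).
(* The flag marks the [R]-end, so that [marked_end] becomes [rend]. *)
pose c := [seq (is_R (prot T d k), (tnth (src d) k, tnth (src e) k)) | k <- enum 'I_3].
have cE : map marked_end c = map (rend T d e) (enum 'I_3).
  by rewrite -map_comp; apply: eq_map => k.
have [||H el] := @eliminates_marked (erase d e G) c.
- by rewrite cE map_inj_uniq ?enum_uniq //; apply: (rend_inj acG dG eG de).
- by rewrite cE => _ /mapP[k _ ->]; apply: (rend_notin_free acG dG eG de).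
exists (cleanup H), H => //; move: el; rewrite -map_comp id_edgesE.
by congr eliminates; apply: eq_map.
Qed.

(** * Preservation by reduction *)

(** An [R]-source of a surviving edge is never an end, so [f] can be cancelled in any equation with
    such a source on one side. The conditions about [R]-occurrences are then reflected to [G]. *)
Lemma acyclic_edges_reduces T G H : acyclic_edges T (free G) (edges G) ->
  reduces G H -> acyclic_edges T (free H) (edges H).
Proof.
move=> acG [d [e [[dG eG de] [G' el ->]]]].
have uG := ac_uniq acG.
have [k|f [eE fF Tf kf]] := eliminates_map (T := T) _ el.
  rewrite id_edgesE => /mapP[k0 _ ->] /=.
  by apply: typed_dual => //; apply: (ac_typed acG).
rewrite /= in eE fF *; rewrite eE; set E := rem e _ in eE *.
have EP a : a \in E -> [/\ a <> e, a <> d & a \in edges G].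
  by rewrite mem_rem2 // => /and3P[/eqP ? /eqP ? ?].
have EG a : a \in E -> a \in edges G by case/EP.
have rd := redex_root_l acG dG eG de; have re := redex_root_r acG dG eG de.
(* Otherwise the source would be an object of [d] or [e], and AC3 would give a chain from [a] to
   that root. *)
have notin_ends a k : a \in E -> prot T a k = ProtR ->
    tnth (src a) k \notin ends (id_edges d e).
  move=> /EP[ae ad aG] kR; rewrite ends_zip ?size_tuple // mem_cat.
  apply/negP => /orP[]/tnthP[l].
    by move/(ac_reach acG aG dG kR)/(edge_reach_root rd).
  by move/(ac_reach acG aG eG kR)/(edge_reach_root re).
have f_inj a k x : a \in E -> prot T a k = ProtR -> f (tnth (src a) k) = f x ->
    tnth (src a) k = x.
  move=> aE kR /kf[//|/andP[+ _]].
  by rewrite (negPf (notin_ends a k aE kR)).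
have protf a k : prot T (map_edge f a) k = prot T a k by rewrite /prot /= Tf.
(* A chain from a surviving edge never meets [d] or [e], since these have no predecessor. *)
have reachE a b : edge_reach T (edges G) a b -> a \in E ->
    b \in E /\ edge_reach T (map (map_edge f) E) (map_edge f a) (map_edge f b).
  elim=> {a b} [a b [aG bG [k kR eq_k]] aE|a aE|a b c _ IH1 _ IH2 aE].
  - have bE : b \in E.
      rewrite mem_rem2 // bG andbT; apply/andP; split; apply/eqP => eq_b.
        by apply: (re a k aG kR); rewrite -eq_b.
      by apply: (rd a k aG kR); rewrite -eq_b.
    split=> //; apply: rt_step; split; rewrite ?map_f //.
    by exists k; rewrite ?protf // tnth_map eq_k.
  - by split=> //; apply: rt_refl.
  - have [bE ab] := IH1 aE; have [cE bc] := IH2 bE.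
    by split=> //; apply: rt_trans ab bc.
split.
(* Edges with equal images share an [R]-source once [f] is cancelled, so linearity makes them
   equal. *)
- rewrite map_inj_in_uniq ?rem_uniq // => a b aE bE eq_ab.
  have [k kR] := exists_protR (epol a) (T (tgt a)).
  have bR : prot T b k = ProtR by rewrite -protf -eq_ab protf.
  have eq_k : f (tnth (src a) k) = f (tnth (src b) k).
    by have := congr1 (fun c => tnth (src c) k) eq_ab; rewrite !tnth_map.
  have := f_inj a k _ aE kR eq_k.
  by case/(ac_linear acG (EG _ aE) (EG _ bE) kR bR).
- move=> _ /mapP[a aE ->]; have := ac_typed acG (EG _ aE).
  by rewrite /typed_edge /= Tf => <-; rewrite -map_comp; apply: eq_map => x /=.
- move=> _ _ k l /mapP[a aE ->] /mapP[b bE ->]; rewrite !protf !tnth_map.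
  move=> kR lR /(f_inj a k _ aE kR).
  by case/(ac_linear acG (EG _ aE) (EG _ bE) kR lR) => -> ->.
(* Merging targets may create new dual pairs. But if an [R]-source of [c] hits the common target,
   cancelling [f] twice shows that [a] and [b] were dual already. *)
- move=> _ _ /mapP[a aE ->] /mapP[b bE ->] [/= np eq_t] _ k /mapP[c cE ->].
  rewrite protf tnth_map /= => kR.
  move=> /[dup] /(f_inj c k _ cE kR) eq_a; rewrite eq_t => /(f_inj c k _ cE kR) eq_b.
  have ab : dual a b by split=> //; rewrite -eq_a.
  exact: (ac_root acG (EG _ aE) (EG _ bE) ab (EG _ cE) kR).
- move=> _ _ k l /mapP[a aE ->] /mapP[b bE ->]; rewrite protf !tnth_map => kR.
  move/(f_inj a k _ aE kR)/(ac_reach acG (EG _ aE) (EG _ bE) kR).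
  by case/reachE.
- move=> _ k l /mapP[a aE ->]; rewrite !protf !tnth_map => kR lS.
  by move/(f_inj a k _ aE kR)/(ac_input acG (EG _ aE) kR lS).
- move=> _ k /mapP[a aE ->]; rewrite protf tnth_map => kR.
  apply/negP; rewrite !inE /= => /andP[/fF[z zF]] /(f_inj a k _ aE kR) eq_z _.
  by have := ac_free acG (EG _ aE) kR; rewrite eq_z zF.
Qed.

Lemma acyclic_edges_acyclic T G : solo_diagram G ->
  acyclic_edges T (free G) (edges G) -> acyclic_solo_diagram G.
Proof.
move=> sG acG; split=> // H GH d e; apply: (@acyclic_edges_redex T).
elim: GH acG => {G H sG} [G H /[swap]|//|G H K _ IH1 _ IH2 /IH1/IH2//].
exact: acyclic_edges_reduces.
Qed.

(** * Transport of the conditions along a renaming of nodes *)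

(** Injectivity of [g] on the nodes of [E'] reflects every equation between sources and targets; the
    types are read through [g]. *)
Lemma acyclic_edges_pullback T g F E F' E' :
  acyclic_edges T F E -> E = map (map_edge g) E' ->
  (forall d e x y, d \in E' -> e \in E' -> x \in edge_nodes d ->
     y \in edge_nodes e -> g x = g y -> x = y) ->
  (forall x, x \in F' -> g x \in F) ->
  acyclic_edges (T \o g) F' E'.
Proof.
move=> acE EE g_inj gF.
have gE a : a \in E' -> map_edge g a \in E by move=> aE; rewrite EE map_f.
have src_nodes a k : tnth (src a) k \in edge_nodes a by rewrite inE mem_tnth orbT.
have tgt_nodes a : tgt a \in edge_nodes a by rewrite inE eqxx.
have inj_edge : {in E' &, injective (map_edge g)}.
  move=> a b aE bE eq_ab; have /= eq_p := congr1 epol eq_ab.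
  have /= eq_t := congr1 tgt eq_ab.
  have {}eq_t : tgt a = tgt b by apply: (g_inj a b).
  have eq_s : src a = src b.
    apply: eq_from_tnth => k; apply: (g_inj a b) => //.
    by have := congr1 (fun c => tnth (src c) k) eq_ab; rewrite !tnth_map.
  by move: eq_p eq_t eq_s; case: (a) (b) => [? ? ?] [? ? ?] /= -> -> ->.
(* Chains lift edge by edge: each next edge lies in [E], hence is an image. *)
have reachE x y : edge_reach T E x y -> forall a, a \in E' -> x = map_edge g a ->
    exists2 b, b \in E' /\ y = map_edge g b & edge_reach (T \o g) E' a b.
  elim=> {x y} [x y [_ + [k kR eq_k]] a aE eq_x|x a aE ->|x y z _ IH1 _ IH2 a aE eq_x].
  - rewrite EE => /mapP[b bE eq_y]; exists b => //; apply: rt_step; split=> //.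
    move: kR eq_k; rewrite eq_x eq_y tnth_map => kR eq_k; exists k => //.
    exact: (g_inj a b).
  - by exists a => //; apply: rt_refl.
  - have [b [bE eq_y] ab] := IH1 _ aE eq_x; have [c cz bc] := IH2 _ bE eq_y.
    by exists c => //; apply: rt_trans ab bc.
split.
- by have := ac_uniq acE; rewrite EE; apply: map_uniq.
- by move=> a /gE /(ac_typed acE); rewrite /typed_edge /= -map_comp.
- move=> a b k l aE bE kR lR eq_kl.
  have [|eq_ab ->] := ac_linear acE (gE _ aE) (gE _ bE) kR lR.
    by rewrite !tnth_map eq_kl.
  by split=> //; apply: inj_edge.
- move=> a b aE bE [np eq_t] c k cE kR eq_k.
  have ab : dual (map_edge g a) (map_edge g b) by split; rewrite //= eq_t.
  apply: (ac_root acE (gE _ aE) (gE _ bE) ab (gE _ cE) kR).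
  by rewrite tnth_map eq_k.
- move=> a b k l aE bE kR eq_kl.
  have /reachE/(_ a aE erefl) : edge_reach T E (map_edge g a) (map_edge g b).
    by apply: (ac_reach acE (gE _ aE) (gE _ bE) kR (l := l)); rewrite !tnth_map eq_kl.
  by case=> c [cE /inj_edge->].
- move=> a k l aE kR lS eq_kl.
  by apply: (ac_input acE (gE _ aE) kR lS); rewrite !tnth_map eq_kl.
- move=> a k aE kR; have := ac_free acE (gE _ aE) kR.
  by rewrite tnth_map; apply: contra => /gF.
Qed.

(** * Alpha-equivalence and typing *)

(** The Euclidean form yields at once that two terms alpha-equivalent to a third are
    alpha-equivalent. The binder lists are kept apart so that any two can be zipped. *)
Lemma same_name_euclid a b c x y z : size a = size b -> size b = size c ->
  same_name (zip a b) x y -> same_name (zip a c) x z -> same_name (zip b c) y z.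
Proof.
elim: a b c => [|a0 a IH] [|b0 b] [|c0 c] //= => [_ _ <-//|[ab] [bc]].
case=> [[-> ->]|[xa [yb xy]]] [[xa' ->]|[xa' [zc xz]]] //; first by left.
by right; do 2!split=> //; apply: IH xy xz.
Qed.

Lemma alpha_under_euclid a b c P Q R : size a = size b -> size b = size c ->
  alpha_under (zip a b) P Q -> alpha_under (zip a c) P R ->
  alpha_under (zip b c) Q R.
Proof.
elim: P Q R a b c => [|s|P1 IH1 P2 IH2|x U P IH] [|t|Q1 Q2|y U' Q]
    [|r|R1 R2|z U'' R] a b c //= ab bc.
- case=> pst ust ost [psr usr osr]; split; first by rewrite -pst.
    exact: same_name_euclid ust usr.
  by move=> k; apply: same_name_euclid (ost k) (osr k).
- by case=> p1 p2 [q1 q2]; split; [apply: IH1 p1 q1|apply: IH2 p2 q2].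
- case=> <- pq [<- pr]; split=> //.
  by apply: (IH Q R (x :: a) (y :: b) (z :: c)); rewrite /= ?ab ?bc.
Qed.

Lemma alpha_under_fn l P Q y : alpha_under l P Q -> y \in fn Q ->
  exists2 x, x \in fn P & same_name l x y.
Proof.
elim: P Q l y => [|s|P1 IH1 P2 IH2|a U P IH] [|t|Q1 Q2|b U' Q] l y //=.
- case=> _ us os; rewrite !inE => /orP[/eqP->|/tnthP[k ->]].
    by exists (subj s); rewrite // !inE eqxx.
  by exists (tnth (obj s) k); rewrite // !inE mem_tnth orbT.
- case=> a1 a2; rewrite inE => /orP[/(IH1 _ _ _ a1)|/(IH2 _ _ _ a2)] [x xP xy];
    by exists x; rewrite // inE xP ?orbT.
- case=> _ al; rewrite !inE => /andP[yb /(IH _ _ _ al)[x xP]] /=.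
  case=> [[_ eq_y]|[/eqP xa [_ xy]]]; first by rewrite eq_y eqxx in yb.
  by exists x; rewrite // !inE xa.
Qed.

Lemma alpha_under_size_bn l P Q : alpha_under l P Q -> size (bn P) = size (bn Q).
Proof.
elim: P Q l => [|s|P1 IH1 P2 IH2|a U P IH] [|t|Q1 Q2|b U' Q] l //=.
  by case=> /IH1 e1 /IH2 e2; rewrite !size_cat e1 e2.
by case=> _ /IH->.
Qed.

(** Alpha-equivalent terms list their binders in the same order, so zipping pairs them; free names
    are paired through [l]. *)
Definition matched l (P Q : term) (x y : name) : Prop :=
  (x, y) \in zip (bn P) (bn Q) \/ [/\ x \in fn P, y \in fn Q & same_name l x y].

(** The matched pairs of a subterm are matched in the whole term, a pair captured by a binder
    becoming a pair of binders; so one [g] serves throughout the induction. *)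
Lemma alpha_under_edges l P Q g : alpha_under l P Q ->
  (forall x y, matched l P Q x y -> g y = x) ->
  map edge_of_solo (solos P) = map (map_edge g) (map edge_of_solo (solos Q)).
Proof.
elim: P Q l => [|s|P1 IH1 P2 IH2|a U P IH] [|t|Q1 Q2|b U' Q] l //=.
- case=> ps us os gP; congr [:: _]; rewrite /edge_of_solo /map_edge /= ps.
  congr MultiEdge; last first.
    by apply/esym/gP; right; rewrite /= !inE !eqxx.
  apply: eq_from_tnth => k; rewrite tnth_map; apply/esym/gP; right.
  by split=> //=; rewrite !inE mem_tnth orbT.
- case=> a1 a2 gP; have sz := alpha_under_size_bn a1; rewrite !map_cat; congr cat.
    apply: IH1 a1 _ => x y xy; apply: gP.
    rewrite /matched /= zip_cat //.
    case: xy => [xy|[xP yQ xy]]; first by left; rewrite mem_cat xy.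
    by right; rewrite !inE xP yQ.
  apply: IH2 a2 _ => x y xy; apply: gP.
  rewrite /matched /= zip_cat //.
  case: xy => [xy|[xP yQ xy]]; first by left; rewrite mem_cat xy orbT.
  by right; rewrite !inE xP yQ !orbT.
- case=> _ al gP; apply: IH al _ => x y xy; apply: gP.
  case: xy => [xy|[xP yQ /= [[-> ->]|[/eqP xa [/eqP yb xy]]]]].
  + by left; rewrite /= inE xy orbT.
  + by left; rewrite /= inE eqxx.
  + by right; rewrite /= !inE xa yb.
Qed.

(** Binders correspond by position. For alpha-equivalent terms the lists are equally long and the
    default [y] is not reached. *)
Definition rename_bn (P Q : term) (y : name) : name :=
  if y \in bn Q then nth y (bn P) (index y (bn Q)) else y.

Lemma alpha_eq_edges P Q : alpha_eq P Q -> distinct_bn Q ->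
  map edge_of_solo (solos P) =
  map (map_edge (rename_bn P Q)) (map edge_of_solo (solos Q)).
Proof.
move=> al [uQ dQ]; apply: (alpha_under_edges al) => x y.
have sz := alpha_under_size_bn al; rewrite /rename_bn => -[xy|[_ yQ /= ->]].
  have [i ilt xyE] := nthP (x, y) xy.
  have := ilt; rewrite size_zip sz minnn => iltQ.
  move: xyE; rewrite nth_zip // => -[xE yE].
  by rewrite -yE mem_nth // index_uniq // -[RHS]xE; apply: set_nth_default; rewrite sz.
by rewrite ifN //; apply/negP => /dQ; rewrite yQ.
Qed.

Lemma alpha_eq_fn P Q y : alpha_eq P Q -> y \in fn Q -> y \in fn P.
Proof. by move=> al /(alpha_under_fn al)[x xP /= <-]. Qed.

(** * Typing under alpha-equivalence and in the joint environment *)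

Lemma typed_alpha_under Gamma Gamma' l P Q : typed Gamma P -> alpha_under l P Q ->
  (forall x y, same_name l x y -> Gamma x = Gamma' y) -> typed Gamma' Q.
Proof.
move=> tP; elim: tP Gamma' l Q => {Gamma P}
  [Gamma|Gamma s ts|Gamma P1 P2 _ IH1 _ IH2|Gamma a U P _ IH] Gamma' l
  [|t|Q1 Q2|b U' Q] //=.
- by move=> _ _; apply: typed_Nil.
- case=> _ us os eqG; apply: typed_Act; move: ts; rewrite /typed_solo (eqG _ _ us).
  have -> // : map Gamma (obj s) = map Gamma' (obj t).
  have : map_tuple Gamma (obj s) = map_tuple Gamma' (obj t).
    by apply: eq_from_tnth => k; rewrite !tnth_map; apply: eqG.
  by move/(congr1 val).
- by case=> a1 a2 eqG; apply: typed_Par; [apply: IH1 a1 _|apply: IH2 a2 _].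
- case=> <- al eqG; apply: typed_Nu; apply: IH al _ => x y /=; rewrite /extend.
  by case=> [[-> ->]|[/eqP/negPf-> [/eqP/negPf-> /eqG]]] //; rewrite !eqxx.
Qed.

Lemma eq_typed_solo Gamma Gamma' s : {in solo_names s, Gamma =1 Gamma'} ->
  typed_solo Gamma s -> typed_solo Gamma' s.
Proof.
move=> eqG; rewrite /typed_solo (eqG (subj s)) ?inE ?eqxx //.
have -> // : map Gamma (obj s) = map Gamma' (obj s).
by apply/eq_in_map => x xs; apply: eqG; rewrite inE xs orbT.
Qed.

Lemma eq_typed Gamma Gamma' P : typed Gamma P ->
  (forall x, x \in fn P -> Gamma x = Gamma' x) -> typed Gamma' P.
Proof.
move=> tP; elim: tP Gamma' => {Gamma P}
  [Gamma|Gamma s ts|Gamma P1 P2 _ IH1 _ IH2|Gamma a U P _ IH] Gamma' eqG.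
- exact: typed_Nil.
- apply: typed_Act; apply: (eq_typed_solo _ ts) => x xs.
  by apply: eqG; move: xs; rewrite /= !inE.
- by apply: typed_Par; [apply: IH1|apply: IH2] => x xP; apply: eqG;
    rewrite /= inE xP ?orbT.
- apply: typed_Nu; apply: IH => x xP; rewrite /extend.
  by case: eqP => // /eqP xa; apply: eqG; rewrite /= !inE xa.
Qed.

Lemma full_env_notin_bn Gamma P x : x \notin bn P -> full_env Gamma P x = Gamma x.
Proof.
elim: P Gamma => [|s|P1 IH1 P2 IH2|a U P IH] Gamma //=.
  by rewrite mem_cat negb_or => /andP[x1 x2]; rewrite IH2 // IH1.
by rewrite inE negb_or => /andP[xa xP]; rewrite IH // /extend (negPf xa).
Qed.

Lemma edge_nodes_fn_bn P e x : e \in map edge_of_solo (solos P) ->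
  x \in edge_nodes e -> (x \in fn P) || (x \in bn P).
Proof.
elim: P => [|s|P1 IH1 P2 IH2|a U P IH] //=.
- by rewrite inE => /eqP->; rewrite !inE orbF.
- rewrite map_cat mem_cat => /orP[/IH1 h|/IH2 h] /h;
    by rewrite inE mem_cat => /orP[]->; rewrite ?orbT.
- by move=> /IH h /h; rewrite !inE; case: (x == a) => //= ->.
Qed.

Lemma fn_solo_names P x : x \in fn P -> x \in flatten (map solo_names (solos P)).
Proof.
elim: P => [|s|P1 IH1 P2 IH2|a U P IH] //=.
- by rewrite cats0 !inE.
- by rewrite inE map_cat flatten_cat mem_cat => /orP[/IH1|/IH2]->; rewrite ?orbT.
- by rewrite !inE => /andP[_ /IH].
Qed.

(** Since the binders are distinct from each other and from the free names, no later binder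
    overwrites the type of a name already in use. *)
Lemma typed_full_env Gamma P : typed Gamma P -> distinct_bn P ->
  forall e, e \in map edge_of_solo (solos P) ->
  exists2 U, full_env Gamma P (tgt e) = Some U
           & map (full_env Gamma P) (src e) =
             if U is V then [:: Some W; Some W; Some V]
             else [:: Some W; Some V; Some V].
Proof.
move=> tP []; elim: P Gamma tP => [|s|P1 IH1 P2 IH2|a U P IH] Gamma tP uP dP e //=.
- rewrite inE => /eqP->; inversion tP as [|? ? ts| |]; subst.
  by case: ts => -[]; [exists V|exists W].
- inversion tP as [| |? ? ? t1 t2|]; subst.
  move: uP; rewrite /= cat_uniq => /and3P[u1 /hasPn n12 u2].
  have d1 x : x \in bn P1 -> x \notin fn P1.
    by move=> xP; have := dP x; rewrite /= mem_cat xP inE negb_or => /(_ isT)/andP[].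
  have d12 x : x \in bn P1 -> x \notin fn P2.
    by move=> xP; have := dP x; rewrite /= mem_cat xP inE negb_or => /(_ isT)/andP[].
  have d2 x : x \in bn P2 -> (x \notin fn P2) && (x \notin fn P1).
    move=> xP; have := dP x; rewrite /= mem_cat xP orbT inE negb_or.
    by move=> /(_ isT)/andP[-> ->].
  rewrite map_cat mem_cat => /orP[eP|].
    have [W0 tW sW] := IH1 _ t1 u1 d1 e eP.
    (* The binders of [P2] occur in [P1] neither free nor bound. *)
    have nb x : x \in edge_nodes e ->
        full_env (full_env Gamma P1) P2 x = full_env Gamma P1 x.
      move=> xe; apply: full_env_notin_bn; apply/negP => x2.
      case/orP: (edge_nodes_fn_bn eP xe) => [x1|x1].
        by case/andP: (d2 _ x2) => _; rewrite x1.
      by have := n12 _ x2; rewrite /= x1.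
    exists W0; first by rewrite nb // inE eqxx.
    by rewrite -sW; apply/eq_in_map => x xs; apply: nb; rewrite inE xs orbT.
  apply: IH2 => //; last by move=> x /d2/andP[].
  (* The binders of [P1] are not free in [P2], so extending the environment by them preserves its
     typing. *)
  apply: eq_typed t2 _ => x x2; rewrite full_env_notin_bn //.
  by apply/negP => /d12; rewrite x2.
- inversion tP as [| | |? ? ? ? t1]; subst; move: uP => /= /andP[aP uP].
  apply: IH => // x xP; have := dP x; rewrite /= !inE xP orbT => /(_ isT).
  by case: eqP => // eq_x; rewrite -eq_x xP in aP.
Qed.

(** * Acyclic terms *)

(** The default [V] only concerns names outside the edges of a typed term. *)
Definition node_type Gamma Q (n : node) : ty := odflt V (full_env Gamma Q n).

Lemma acyclic_edges_term Gamma Q : typed Gamma Q -> distinct_bn Q ->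
  AC1 Gamma Q -> AC2 Gamma Q -> AC3 Gamma Q -> AC4 Gamma Q -> AC5 Gamma Q ->
  acyclic_edges (node_type Gamma Q) (fn Q) (map edge_of_solo (solos Q)).
Proof.
move=> tQ dQ ac1 ac2 ac3 ac4 ac5; have tyQ := typed_full_env tQ dQ.
set T := node_type Gamma Q; set E := map _ _.
pose edge_at (s : solo_index Q) := edge_of_solo (solo_at s).
have sE : size E = size (solos Q) by rewrite size_map.
have edge_atE (s : solo_index Q) : edge_at s = nth (edge_at s) E s.
  rewrite (nth_map (solo_at s)) //; congr edge_of_solo.
  exact: (tnth_nth (solo_at s) (in_tuple (solos Q)) s).
have atE s : edge_at s \in E by rewrite edge_atE mem_nth // sE.
have Eat e : e \in E -> exists s, e = edge_at s.
  move/(nthP e)=> [i]; rewrite sE => iQ <-; exists (Ordinal iQ).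
  by rewrite edge_atE; apply: set_nth_default; rewrite sE.
have occP s k p x : prot T (edge_at s) k = p -> tnth (src (edge_at s)) k = x ->
    proto_occ Gamma p x s k.
  move=> kp kx; split=> //; have [U tU _] := tyQ _ (atE s); exists U => //.
  by move: kp; rewrite /prot /T /node_type tU.
have occR s k p x : proto_occ Gamma p x s k -> prot T (edge_at s) k = p.
  by case=> _ [U tU <-]; rewrite /prot /T /node_type /= tU.
have reachE s t : prec_star Gamma s t -> edge_reach T E (edge_at s) (edge_at t).
  elim=> {s t} [s t [k st]|s|s t r _ IH1 _ IH2].
  - apply: rt_step; split=> //; exists k; first exact: occR st.
    by case: st.
  - exact: rt_refl.
  - exact: rt_trans IH1 IH2.
split.
(* [uniqP] wants a default element, taken from [E] itself. Equal edges at two positions give two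
   [R]-occurrences of one name, which AC1 identifies. *)
- have [s0|[e0 _]] : E = [::] \/ exists e, e \in E.
    by case: (E) => [|e ?]; [left|right; exists e; rewrite inE eqxx].
  by rewrite s0.
  apply/(uniqP e0) => i j; rewrite !inE sE => iE jE eq_ij.
  pose s : solo_index Q := Ordinal iE; pose t : solo_index Q := Ordinal jE.
  have eq_st : edge_at s = edge_at t.
    rewrite edge_atE (set_nth_default e0) ?sE //= eq_ij [RHS]edge_atE.
    by apply: set_nth_default; rewrite sE.
  have [k kR] := exists_protR (epol (edge_at s)) (T (tgt (edge_at s))).
  have sR := occP s k _ _ kR erefl.
  have tR : proto_occ Gamma ProtR (tnth (src (edge_at s)) k) t k.
    by apply: occP; rewrite -eq_st.
  by have [/(congr1 val)] := ac1 _ _ _ _ _ sR tR.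
- move=> e /tyQ[U tU sU]; rewrite /typed_edge {2}/T /node_type tU /=.
  have -> : map T (src e) = map (odflt V) (map (full_env Gamma Q) (src e)).
    by rewrite -map_comp.
  by rewrite sU; case: (U).
- move=> d e k l /Eat[s ->] /Eat[t ->] kR lR eq_kl.
  by have [-> ->] := ac1 _ _ _ _ _ (occP _ _ _ _ kR eq_kl) (occP _ _ _ _ lR erefl).
- move=> d e /Eat[s ->] /Eat[t ->] [np eq_t] a k /Eat[r ->] kR eq_k.
  have [|rs _] := ac2 s t; first by [].
  by apply: (rs r); exists k; apply: occP.
- move=> d e k l /Eat[s ->] /Eat[t ->] kR eq_kl; apply: reachE.
  by apply: (ac3 s (tnth (src (edge_at t)) l)); [exists k; apply: occP|exists l].
- move=> e k l /Eat[s ->] kR lS eq_kl.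
  by apply: (ac4 (tnth (src (edge_at s)) l) s); [exists l|exists k]; apply: occP.
- move=> e k /Eat[s ->] kR; apply/negP => xF.
  exact: ac5 xF (occP _ _ _ _ kR erefl).
Qed.

Lemma solo_diagram_of_distinct Q : solo_diagram (diagram_of_distinct Q).
Proof.
have tE n : touched (diagram_of_distinct Q) n =
    (n \in nodes (diagram_of_distinct Q)).
  rewrite /touched /= in_fset /= has_map.
  by elim: (solos Q) => //= s ss ->; rewrite !inE mem_cat orbA.
split=> n; rewrite ?tE //= => nF.
by rewrite in_fset /= fn_solo_names.
Qed.

Theorem theorem5p14 (Gamma : env) (P : term) (G : diagram) :
  acyclic_term Gamma P -> diagram_of P G -> acyclic_solo_diagram G.
Proof.
case=> tP [Q [alQ dQ] [ac1 ac2 ac3 ac4 ac5]] [Q' [alQ' dQ'] ->].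
have tQ : typed Gamma Q by apply: typed_alpha_under tP alQ _ => x y /= ->.
have acQ := acyclic_edges_term tQ dQ ac1 ac2 ac3 ac4 ac5.
have QQ' : alpha_eq Q Q'.
  exact: (@alpha_under_euclid [::] [::] [::] P).
have Q'Q : alpha_eq Q' Q.
  exact: (@alpha_under_euclid [::] [::] [::] P).
apply: (acyclic_edges_acyclic (solo_diagram_of_distinct Q')).
have eQ := alpha_eq_edges QQ' dQ'.
apply: (acyclic_edges_pullback acQ eQ) => [d e x y dE eE xd ye|x xF].
  (* Renaming to [Q] and back maps each edge of [Q'] to itself, hence fixes its nodes; so
     [rename_bn Q Q'] is injective on them. *)
  have fixed z a : a \in map edge_of_solo (solos Q') -> z \in edge_nodes a ->
      rename_bn Q' Q (rename_bn Q Q' z) = z.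
    move=> aE za; have := alpha_eq_edges Q'Q dQ.
    rewrite eQ -map_comp -[X in X = _]map_id => /eq_in_map /(_ a aE) /= eq_a.
    move: za; rewrite inE => /orP[/eqP->|/tnthP[k ->]].
      by have /= := congr1 tgt eq_a.
    by have := congr1 (fun c => tnth (src c) k) eq_a; rewrite /= !tnth_map.
  by move=> /(congr1 (rename_bn Q' Q)); rewrite (fixed _ d) // (fixed _ e).
rewrite /rename_bn ifN; first exact: alpha_eq_fn xF.
by apply/negP => /(proj2 dQ'); rewrite xF.
Qed.
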